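(* Let $K=\{a^nb^n:n\ge1\}$, $L_0=K^*\subseteq\{a,b\}^*$, and let $h$ be the first/last/$ba$ morphism defined in the context. Every live non-unit relative class of $(L_0,h)$ has a unique exact factorization into relative primes, namely the following. With $$A=\{a\},\ B=\{b\},\ C=K,\ D=bL_0a,\ E=bL_0K,\ F=KL_0a,\ G=KL_0K$$ (the relative primes of $(L_0,h)$), the live non-unit relative classes and their unique exact prime factorizations are: $A_r=\{a^r\}=A^r$ and $B_r=\{b^r\}=B^r$ for $r\ge1$; for $d\in\mathbb Z$, $C_d=\{a^ib^j:i,j\ge1,\ i-j=d\}$ equals $A^dC$ if $d>0$, $C$ if $d=0$, $CB^{-d}$ if $d<0$; for $c,e\ge1$, $X_{c,e}=b^cL_0a^e=B^{c-1}DA^{e-1}$; for $c\ge1,e\ge0$, $Y_{c,e}=b^cL_0a^eK$ equals $B^{c-1}E$ if $e=0$ and $B^{c-1}DA^{e-1}C$ if $e\ge1$; for $c\ge0,e\ge1$, $Z_{c,e}=Kb^cL_0a^e$ equals $FA^{e-1}$ if $c=0$ and $CB^{c-1}DA^{e-1}$ if $c\ge1$; for $c,e\ge0$, $W_{c,e}=Kb^cL_0a^eK$ equals $G$ if $c=e=0$, $FA^{e-1}C$ if $c=0,e\ge1$, $CB^{c-1}E$ if $c\ge1,e=0$, and $CB^{c-1}DA^{e-1}C$ if $c,e\ge1$.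
   Context: The morphism: $h(w)=(\mathrm{fst}(w),\mathrm{lst}(w),\mathrm{ba}(w))$ for $w\in\{a,b\}^*$, where $\mathrm{fst}(w),\mathrm{lst}(w)\in\{\bot,a,b\}$ are the first and last letters of $w$ ($\bot$ for the empty word) and $\mathrm{ba}(w)\in\{0,1\}$ records whether $w$ contains the factor $ba$. It is a morphism onto a finite monoid with the induced concatenation product. General definitions, for $L\subseteq\Sigma^*$ and a monoid morphism $h:\Sigma^*\to M$ into a finite monoid: $D_L(x)=\{(u,v):uxv\in L\}$; $x\equiv_L y$ iff $D_L(x)=D_L(y)$. The relative syntactic congruence $\theta$: $x\,\theta\,y$ iff $x\equiv_L y$ and $h(x)=h(y)$; its classes $[x]$ are called relative classes. A relative class is live if $D_L(x)\neq\varnothing$ for its members. The unit class is $[\varepsilon]$; non-unit means different from it. $X\cdot Y=XY=\{xy:x\in X,y\in Y\}$, and powers/juxtaposition of classes in the claim denote such setwise products. A relative prime is a live non-unit relative class $P$ such that whenever $P=X\cdot Y$ (equality of sets) for relative classes $X,Y$, one of $X,Y$ is $[\varepsilon]$. An exact factorization of $X$ into relative primes is a finite nonempty sequence of relative primes whose setwise product equals $X$; uniqueness refers to the sequence. *)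

(* Defs.v *)
From Stdlib Require List.
From HB Require Import structures.
From mathcomp Require Import all_boot all_order all_algebra.
From mathcomp Require Import boolp classical_sets.

Set Implicit Arguments.
Unset Strict Implicit.
Unset Printing Implicit Defensive.

Local Open Scope classical_set_scope.

Definition lprod (S : Type) (X Y : set (seq S)) : set (seq S) :=
  [set x ++ y | x in X & y in Y].

Notation "X ** Y" := (lprod X Y) (at level 40, left associativity).

Definition lprods (S : Type) (s : seq (set (seq S))) : set (seq S) :=
  foldr (@lprod S) [set [::]] s.

Definition kstar (S : Type) (X : set (seq S)) : set (seq S) :=
  [set flatten ws | ws in [set ws | forall w, List.In w ws -> X w]].

Definition contexts (S : Type) (L : set (seq S)) (x : seq S) :
    set (seq S * seq S) :=
  [set uv | L (uv.1 ++ x ++ uv.2)].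

Definition syn_equiv (S : Type) (L : set (seq S)) (x y : seq S) : Prop :=
  contexts L x = contexts L y.

(* The notions below depend on h only through the relation h x = h y, so its
   codomain is a bare type; for the particular h used here, the monoid law is
   hmul and the morphism property is h_nil and h_cat. *)
Definition theta (S M : Type) (L : set (seq S)) (h : seq S -> M)
    (x y : seq S) : Prop :=
  syn_equiv L x y /\ h x = h y.

Definition class_of (S M : Type) (L : set (seq S)) (h : seq S -> M)
    (x : seq S) : set (seq S) :=
  [set y | theta L h x y].

Definition relative_class (S M : Type) (L : set (seq S)) (h : seq S -> M)
    (X : set (seq S)) : Prop :=
  exists x, X = class_of L h x.

Definition live (S : Type) (L : set (seq S)) (X : set (seq S)) : Prop :=
  forall x, X x -> contexts L x !=set0.

Definition unit_class (S M : Type) (L : set (seq S)) (h : seq S -> M) :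
    set (seq S) :=
  class_of L h [::].

Definition live_nonunit_class (S M : Type) (L : set (seq S)) (h : seq S -> M)
    (X : set (seq S)) : Prop :=
  [/\ relative_class L h X, live L X & X <> unit_class L h].

Definition relative_prime (S M : Type) (L : set (seq S)) (h : seq S -> M)
    (P : set (seq S)) : Prop :=
  live_nonunit_class L h P /\
  forall X Y, relative_class L h X -> relative_class L h Y -> P = X ** Y ->
    X = unit_class L h \/ Y = unit_class L h.

Definition exact_factorization (S M : Type) (L : set (seq S))
    (h : seq S -> M) (X : set (seq S)) (s : seq (set (seq S))) : Prop :=
  [/\ s <> [::], forall P, List.In P s -> relative_prime L h P
    & lprods s = X].

Definition unique_exact_factorization (S M : Type) (L : set (seq S))
    (h : seq S -> M) (X : set (seq S)) (s : seq (set (seq S))) : Prop :=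
  unique (exact_factorization L h X) s.

Inductive letter : Type := la | lb.

Definition letter_eqb (x y : letter) : bool :=
  match x, y with la, la | lb, lb => true | _, _ => false end.

Lemma letter_eqP : Equality.axiom letter_eqb.
Proof. by case; case; constructor. Qed.

HB.instance Definition _ := hasDecEq.Build letter letter_eqP.

Notation word := (seq letter).

Definition fst_letter (w : word) : option letter := ohead w.
Definition lst_letter (w : word) : option letter := ohead (rev w).
Definition has_ba (w : word) : bool := infix [:: lb; la] w.

Definition hval : Type := (option letter * option letter * bool)%type.

Definition h (w : word) : hval := (fst_letter w, lst_letter w, has_ba w).

Definition hone : hval := (None, None, false).

(* The product that concatenation induces on the image of h; outside that
   image it has no meaning (it is not associative on all of hval). *)
Definition hmul (x y : hval) : hval :=
  let: (f1, l1, b1) := x in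
  let: (f2, l2, b2) := y in
  (if f1 is Some _ then f1 else f2,
   if l2 is Some _ then l2 else l1,
   [|| b1, b2 | (l1 == Some lb) && (f2 == Some la)]).

Lemma h_nil : h [::] = hone.
Proof. by []. Qed.

Lemma has_ba_cat (x y : word) :
  has_ba (x ++ y) = [|| has_ba x, has_ba y
    | (lst_letter x == Some lb) && (fst_letter y == Some la)].
Proof.
rewrite /has_ba /lst_letter /fst_letter.
elim: x => [|c x IH]; first by rewrite /= orbF.
rewrite cat_cons [LHS]/= [infix _ (c :: x)]/= IH rev_cons.
case: x {IH} => [|d x].
  by case: c; case: y => [|[] [|? ?]] //=; rewrite ?orbT ?orbF.
rewrite rev_cons /=; case: (rev x) => [|e r] /=; case: c => //=;
  case: d => //=; by rewrite ?prefix0s ?orbA.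
Qed.

Lemma h_cat (x y : word) : h (x ++ y) = hmul (h x) (h y).
Proof.
rewrite /h /= has_ba_cat; congr (_, _, _).
  by rewrite /fst_letter; case: x.
by rewrite /lst_letter rev_cat; case: (rev y).
Qed.

Definition apow (n : nat) : set word := [set nseq n la].
Definition bpow (n : nat) : set word := [set nseq n lb].

Definition K : set word :=
  [set w | exists2 n, (1 <= n)%N & w = nseq n la ++ nseq n lb].
Definition L0 : set word := kstar K.

Definition pA : set word := [set [:: la]].
Definition pB : set word := [set [:: lb]].
Definition pC : set word := K.
Definition pD : set word := pB ** L0 ** pA.
Definition pE : set word := pB ** L0 ** K.
Definition pF : set word := K ** L0 ** pA.
Definition pG : set word := K ** L0 ** K.

Definition clA (r : nat) : set word := apow r.
Definition clB (r : nat) : set word := bpow r.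
Definition clC (d : int) : set word :=
  [set w | exists i j : nat, [/\ (1 <= i)%N, (1 <= j)%N,
     (i%:Z - j%:Z = d)%R & w = nseq i la ++ nseq j lb]].
Definition clX (c e : nat) : set word := bpow c ** L0 ** apow e.
Definition clY (c e : nat) : set word := bpow c ** L0 ** apow e ** K.
Definition clZ (c e : nat) : set word := K ** bpow c ** L0 ** apow e.
Definition clW (c e : nat) : set word := K ** bpow c ** L0 ** apow e ** K.

Definition facA (r : nat) : seq (set word) := nseq r pA.
Definition facB (r : nat) : seq (set word) := nseq r pB.

Definition facC (d : int) : seq (set word) :=
  if (0 < d)%R then nseq `|d|%N pA ++ [:: pC]
  else if d == 0%R then [:: pC]
  else pC :: nseq `|d|%N pB.

Definition facX (c e : nat) : seq (set word) :=
  nseq c.-1 pB ++ [:: pD] ++ nseq e.-1 pA.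

Definition facY (c e : nat) : seq (set word) :=
  if e == 0%N then nseq c.-1 pB ++ [:: pE]
  else nseq c.-1 pB ++ [:: pD] ++ nseq e.-1 pA ++ [:: pC].

Definition facZ (c e : nat) : seq (set word) :=
  if c == 0%N then [:: pF] ++ nseq e.-1 pA
  else [:: pC] ++ nseq c.-1 pB ++ [:: pD] ++ nseq e.-1 pA.

Definition facW (c e : nat) : seq (set word) :=
  match c == 0%N, e == 0%N with
  | true, true => [:: pG]
  | true, false => [:: pF] ++ nseq e.-1 pA ++ [:: pC]
  | false, true => [:: pC] ++ nseq c.-1 pB ++ [:: pE]
  | false, false =>
      [:: pC] ++ nseq c.-1 pB ++ [:: pD] ++ nseq e.-1 pA ++ [:: pC]
  end.

(* Main.v *)
Require Import Defs.
From mathcomp Require Import all_boot all_order all_algebra.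
From mathcomp Require Import boolp classical_sets.
From mathcomp Require Import zify.

(* The language L0 is recognised by a one-counter automaton, and two words are
   congruent as soon as they act equally on its states; this makes every
   live relative class one of an explicit family of languages.

   For uniqueness, let P R be one of these languages, where P is one of the
   seven candidate primes and R is a product of candidate primes.  Such an R
   never contains words with different values of h, and this forces P to be
   the first factor of the listed factorization and R to be the product of the
   remaining factors: e.g. in A R = K L0 K, the words abab and aabbab would put
   both bab and abbab in R.  Hence a product of candidate primes that is a
   class has only one factorization, and this already implies that the
   candidates are irreducible: a factorization of P into two classes would
   refine to a factorization of P with at least two factors. *)

Set Implicit Arguments.
Unset Strict Implicit.
Unset Printing Implicit Defensive.

Local Open Scope classical_set_scope.
Local Arguments h : simpl never.

(** * Products of languages *)

Lemma lprodP (S : Type) (X Y : set (seq S)) w :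
  (X ** Y) w <-> exists x y, [/\ X x, Y y & w = x ++ y].
Proof.
split; first by case=> x Xx [y Yy <-]; exists x, y.
by case=> x [y [Xx Yy ->]]; exists x => //; exists y.
Qed.

Lemma lprod_cat (S : Type) (X Y : set (seq S)) x y :
  X x -> Y y -> (X ** Y) (x ++ y).
Proof. by move=> Xx Yy; exists x => //; exists y. Qed.

Lemma lprodA (S : Type) : associative (@lprod S).
Proof.
move=> X Y Z; apply/seteqP; split=> w.
  move=> /lprodP[x [_ [Xx /lprodP[y [z [Yy Zz ->]]] ->]]].
  by rewrite catA; do 2?apply: lprod_cat.
move=> /lprodP[_ [z [/lprodP[x [y [Xx Yy ->]]] Zz ->]]].
by rewrite -catA; do 2?apply: lprod_cat.
Qed.

Lemma lprod1l (S : Type) : left_id [set [::]] (@lprod S).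
Proof.
move=> X; apply/seteqP; split=> w; first by case=> _ -> [y Yy <-].
exact: (@lprod_cat _ [set [::]] X [::]).
Qed.

Lemma lprod1r (S : Type) : right_id [set [::]] (@lprod S).
Proof.
move=> X; apply/seteqP; split=> w.
  by case=> x Xx [_ -> <-]; rewrite cats0.
by move=> Xw; rewrite -[w]cats0; apply: lprod_cat.
Qed.

Lemma lprods_cons (S : Type) (X : set (seq S)) s :
  lprods (X :: s) = X ** lprods s.
Proof. by []. Qed.

Lemma lprods_cat (S : Type) (s t : seq (set (seq S))) :
  lprods (s ++ t) = lprods s ** lprods t.
Proof.
elim: s => [|X s IH] /=; first by rewrite lprod1l.
by rewrite [lprods _]IH lprodA.
Qed.

Lemma lprods1 (S : Type) (X : set (seq S)) : lprods [:: X] = X.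
Proof. exact: lprod1r. Qed.

Lemma lprods_nseq (n : nat) (c : letter) :
  lprods (nseq n [set [:: c]]) = [set nseq n c].
Proof.
elim: n => //= n; rewrite /lprods => ->; apply/seteqP; split=> w.
  by case=> _ -> [_ -> <-].
by move=> ->; exists [:: c] => //; exists (nseq n c).
Qed.

Lemma pow_add (m n : nat) (c : letter) :
  [set nseq m c] ** [set nseq n c] = [set nseq (m + n) c].
Proof. by rewrite -!lprods_nseq -lprods_cat nseqD. Qed.

(** * The languages [K] and [L0] *)

Lemma K_ab n : K (nseq n.+1 la ++ nseq n.+1 lb).
Proof. by exists n.+1. Qed.

Lemma KP w : K w -> exists n, w = nseq n.+1 la ++ nseq n.+1 lb.
Proof. by case=> -[//|n] _ ->; exists n. Qed.

Lemma L0_nil : L0 [::].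
Proof. by exists [::]. Qed.

Lemma L0_K k x : K k -> L0 x -> L0 (k ++ x).
Proof.
move=> Kk [ws Kws <-]; exists (k :: ws) => // w /= [<- //|]; exact: Kws.
Qed.

Lemma L0_cat x y : L0 x -> L0 y -> L0 (x ++ y).
Proof.
case=> ws + <-; elim: ws => [//|k ws IH] Kws L0y /=; rewrite -catA.
apply: L0_K; first by apply: Kws; left.
by apply: IH => // w ?; apply: Kws; right.
Qed.

Lemma K_L0 : K `<=` L0.
Proof. by move=> k Kk; rewrite -[k]cats0; apply: L0_K => //; apply: L0_nil. Qed.

Lemma L0_inv x : L0 x -> x = [::] \/ exists k y, [/\ K k, L0 y & x = k ++ y].
Proof.
case=> [[|k ws]] Kws <-; [by left | right; exists k, (flatten ws); split => //].
  by apply: Kws; left.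
by exists ws => // w ?; apply: Kws; right.
Qed.

(** * An automaton for L0 *)

(* [Up n]: n letters a of the current block have been read; [Owe n]: n.+1
   letters b are still due.  [Up 0] is both initial and accepting. *)
Inductive state := Up of nat | Owe of nat | Dead.

(** The state with n letters b due. Zero due means that a block has just been closed, which puts the
    automaton back in its initial state. *)
Definition owe n := if n is m.+1 then Owe m else Up 0.

Definition step q c :=
  match q with
  | Up n => if c is la then Up n.+1 else if n is m.+1 then owe m else Dead
  | Owe n => if c is lb then owe n else Dead
  | Dead => Dead
  end.

Notation run := (foldl step).

Lemma run_cat q x y : run q (x ++ y) = run (run q x) y.
Proof. exact: foldl_cat. Qed.

Lemma run_Dead w : run Dead w = Dead.
Proof. by elim: w. Qed.

Lemma run_Up_a n i : run (Up n) (nseq i la) = Up (n + i).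
Proof. by elim: i n => [|i IH] n /=; rewrite ?addn0 // IH addSnnS. Qed.

Lemma run_owe_b n j :
  run (owe n) (nseq j lb) = if j <= n then owe (n - j) else Dead.
Proof.
elim: j n => [|j IH] n /=; first by rewrite subn0.
by case: n => [|n] /=; rewrite ?run_Dead // ltnS IH.
Qed.

Lemma run_Up_b n j :
  run (Up n) (nseq j.+1 lb) = if j < n then owe (n - j.+1) else Dead.
Proof. by rewrite -run_owe_b; case: n. Qed.

Lemma run_Up_ab n i j :
  run (Up n) (nseq i la ++ nseq j.+1 lb) =
  if j < n + i then owe (n + i - j.+1) else Dead.
Proof. by rewrite run_cat run_Up_a run_Up_b. Qed.

Lemma run_Up_K n k : K k -> run (Up n) k = owe n.
Proof.
by move=> /KP[m ->]; rewrite run_Up_ab addnK ifT ?leq_addl.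
Qed.

Lemma run_Owe_inv n w : run (Owe n) w = Up 0 ->
  exists2 y, w = nseq n.+1 lb ++ y & run (Up 0) y = Up 0.
Proof.
elim: n w => [|n IH] [|[] w] //=; rewrite ?run_Dead //.
  by exists w.
by move=> /IH[y -> ?]; exists y.
Qed.

Lemma run_L0 w : L0 w -> run (Up 0) w = Up 0.
Proof.
case=> ws + <-; elim: ws => [//|k ws IH] Kws /=.
rewrite run_cat (run_Up_K 0); last by apply: Kws; left.
by apply: IH => x ?; apply: Kws; right.
Qed.

(** Putting the n letters a already read back in front of w turns acceptance from any [Up n] into
    membership. The induction is on the length of w because the closing letters b of a block are
    removed all at once. *)
Lemma L0_run n w : run (Up n) w = Up 0 -> L0 (nseq n la ++ w).
Proof.
have [m] := ubnP (size w); elim: m n w => [//|m IH] n [|[] w] /=; rewrite ?ltnS.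
- by move=> _ [->]; apply: L0_nil.
- move=> lt_w /(IH n.+1 w lt_w); rewrite -[la :: w]cat1s catA.
  by rewrite -(nseqD n 1) addn1.
case: n => [|[|n]] lt_w /=; first by rewrite run_Dead.
  by move=> /(IH 0 w lt_w); apply: (@L0_K [:: la; lb]); apply: (K_ab 0).
(* The block is committed to its descent, so w must first pay the remaining n.+1 letters b; what
   follows is a shorter accepted word. *)
move=> /run_Owe_inv[y def_w run_y].
have L0y : L0 y.
  apply: (IH 0) => //; move: lt_w; rewrite def_w size_cat size_nseq /=; lia.
by have := L0_K (K_ab n.+1) L0y; rewrite -catA def_w.
Qed.

Lemma L0P w : L0 w <-> run (Up 0) w = Up 0.
Proof. by split; [apply: run_L0 | apply: (@L0_run 0)]. Qed.

(** * Live words *)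

(* [IA 0] and [IB 0] both denote the unit class. *)
Inductive class_index :=
  | IA of nat
  | IB of nat
  | IC of int
  | IT of bool & nat & nat & bool.

Definition optK (f : bool) : set word := if f then K else [set [::]].

Lemma optK_nonempty f : optK f !=set0.
Proof. by case: f; eexists; [apply: (K_ab 0) | reflexivity]. Qed.

Definition lang (Q : class_index) : set word :=
  match Q with
  | IA r => clA r
  | IB r => clB r
  | IC d => clC d
  | IT f c e l => optK f ** bpow c ** L0 ** apow e ** optK l
  end.

(** For [IT], the part before [L0] must end in b and the part after it must begin with a, so that
    every word of the language contains ba. *)
Definition wf (Q : class_index) : bool :=
  if Q is IT f c e l then (f || (0 < c)) && (l || (0 < e)) else true.

Lemma langTP f c e l w : lang (IT f c e l) w <->
  exists k x k', [/\ optK f k, L0 x, optK l k' &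
    w = k ++ nseq c lb ++ x ++ nseq e la ++ k'].
Proof.
rewrite /= -!lprodA; split; last first.
  case=> k [x [k' [fk L0x lk' ->]]].
  by do 4![apply: lprod_cat => //].
case/lprodP=> k [_ [fk /lprodP[_ [v [-> Lw ->]]] ->]].
case/lprodP: Lw => x [_ [L0x /lprodP[_ [k' [-> lk' ->]]] ->]].
by exists k, x, k'.
Qed.

Lemma clCP d w : clC d w <->
  exists i j : nat, (i%:Z - j%:Z = d)%R /\ w = nseq i.+1 la ++ nseq j.+1 lb.
Proof.
split; first by case=> -[|i] [[|j] [//_ // _ eq_d ->]]; exists i, j; split=> //; lia.
by case=> i [j [eq_d ->]]; exists i.+1, j.+1; split=> //; lia.
Qed.

Lemma clC_pos n w : clC n%:Z w <->
  exists j, w = nseq (n + j.+1) la ++ nseq j.+1 lb.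
Proof.
rewrite clCP; split=> [[i [j [eq_d ->]]]|[j ->]].
  by exists j; congr (nseq _ _ ++ _); lia.
by exists (n + j), j; rewrite addnS; split => //; lia.
Qed.

Lemma clC_neg n w : clC (- n%:Z)%R w <->
  exists i, w = nseq i.+1 la ++ nseq (n + i.+1) lb.
Proof.
rewrite clCP; split=> [[i [j [eq_d ->]]]|[i ->]].
  by exists i; congr (_ ++ nseq _ _); lia.
by exists i, (n + i); rewrite addnS; split => //; lia.
Qed.

(** The state after a surviving run on a word of [IT f c e l]: the last e letters a outside the
    final [K] word are still open, and that [K] word, if present, commits the automaton to closing
    them. *)
Definition out e (l : bool) := if l then owe e else Up e.

(** The word begins with a, either through a block of x or through the a's and [K] word behind it,
    so it kills every state that still owes a b. *)
Lemma run_L0_a_K m x e l k : L0 x -> optK l k -> l || (0 < e) ->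
  run (owe m) (x ++ nseq e la ++ k) = if m == 0 then out e l else Dead.
Proof.
move=> L0x lk le; case: m => [|m] /=.
  rewrite !run_cat (run_L0 L0x) run_Up_a add0n.
  by case: l lk {le} => [/run_Up_K ->|->].
case: (L0_inv L0x) => [-> |[_ [y [/KP[n ->] _ ->]]]]; last by rewrite /= run_Dead.
case: e le => [|e] /=; last by rewrite run_Dead.
by case: l lk => // /KP[n ->] _ /=; rewrite run_Dead.
Qed.

(** The b's before [L0] must pay exactly what is due: with too many the run dies at once, with too
    few it dies at the a that follows. Hence the action on states depends on the index alone. *)
Lemma run_T f c e l w q : wf (IT f c e l) -> lang (IT f c e l) w ->
  run q w = match q with
            | Up n => if n == c then out e l else Dead
            | Owe n => if ~~ f && (n.+1 == c) then out e l else Dead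
            | Dead => Dead
            end.
Proof.
move=> /andP[fc le] /langTP[k [x [k' [fk L0x lk' ->]]]].
have run_bc m : run (owe m) (nseq c lb ++ x ++ nseq e la ++ k') =
    if m == c then out e l else Dead.
  rewrite run_cat run_owe_b; case: leqP => [le_cm|lt_mc].
    by rewrite (run_L0_a_K _ L0x lk' le) subn_eq0 eqn_leq le_cm andbT.
  by rewrite run_Dead ltn_eqF.
case: q => [n|n|]; last exact: run_Dead.
- case: f fc fk => /= [_ Kk|]; first by rewrite run_cat (run_Up_K _ Kk).
  case: c run_bc => // c run_bc _ ->; rewrite -run_bc.
  by case: n.
- case: f fc fk => /= [_ /KP[m ->]|]; first by rewrite /= run_Dead.
  by move=> _ ->; rewrite -(run_bc n.+1).
Qed.

Lemma contexts_L0 x u v : contexts L0 x (u, v) <-> L0 (u ++ x ++ v).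
Proof. by []. Qed.

Lemma live_run x : contexts L0 x !=set0 -> exists q, run q x <> Dead.
Proof.
case=> -[u v] /contexts_L0/L0P; rewrite !run_cat => run_uxv.
by exists (run (Up 0) u) => dead; rewrite dead run_Dead in run_uxv.
Qed.

(** With a surplus of a's in w, some b is still due after w, and a further a is fatal. *)
Lemma run_clC_a d w q : (0 < d)%R -> clC d w -> run q (rcons w la) = Dead.
Proof.
move=> d_gt0 /clCP[i [j [eq_d ->]]]; rewrite -cats1 -catA.
case: q => [n|n|]; last exact: run_Dead.
  rewrite catA run_cat run_Up_ab; case: ltnP => //= _.
  by rewrite (_ : _ - _ = (n + i - j).-1.+1) //; lia.
by rewrite /= run_Dead.
Qed.

Lemma nseq_rcons n (c : letter) : nseq n.+1 c = rcons (nseq n c) c.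
Proof. by elim: n => //= n <-. Qed.

(** Each index has a successor index for each letter, except where that letter kills every run: a
    after [IC d] with d > 0, and, after [IT] with a final [K], a when e > 0 and b when e = 0. *)
Lemma lang_rcons Q w c : wf Q -> lang Q w ->
    (exists q, run q (rcons w c) <> Dead) ->
  exists2 Q', wf Q' & lang Q' (rcons w c).
Proof.
case: Q => [r|r|d|f c0 e l] wfQ.
- move=> {wfQ} -> _; case: c; first by exists (IA r.+1); rewrite -?nseq_rcons.
  case: r => [|r]; first by exists (IB 1).
  exists (IC r%:Z) => //; apply/clC_pos; exists 0.
  by rewrite addn1 -cats1.
- move=> {wfQ} -> _; case: c; last by exists (IB r.+1); rewrite -?nseq_rcons.
  case: r => [|r]; first by exists (IA 1).
  exists (IT false r.+1 1 false) => //; apply/langTP; exists [::], [::], [::].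
  by rewrite -cats1; split => //; apply: L0_nil.
- move=> Cw live_wc; case: c live_wc; last first.
    move=> _; exists (IC (d - 1)%R) => //; case/clCP: Cw => i [j [eq_d ->]].
    apply/clCP; exists i, j.+1; split; first by lia.
    by rewrite (nseq_rcons j.+1) -rcons_cat.
  have [d_gt0 [q]|d_le0 _] := boolP (0 < d)%R.
    by rewrite (run_clC_a _ d_gt0 Cw).
  have [n def_d] : exists n : nat, d = (- n%:Z)%R by exists `|d|%N; lia.
  move: Cw; rewrite def_d => /clC_neg[i ->].
  (* A word of [clC] with d = -n is a [K] word followed by b^n; the new a is the e-part, and the
     [L0] part between them is empty. *)
  exists (IT true n 1 false) => //; apply/langTP.
  exists (nseq i.+1 la ++ nseq i.+1 lb), [::], [::]; split => //.
  + exact: K_ab.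
  + exact: L0_nil.
  + by rewrite -catA /= addnC nseqD -cats1 -!catA.
move=> Tw; have run_w q := run_T q wfQ Tw.
(* Every surviving run on w ends in [out e l], so this single state must survive the letter c. *)
have out_live : (exists q, run q (rcons w c) <> Dead) -> step (out e l) c <> Dead.
  case=> q; rewrite -cats1 run_cat run_w; case: q => [n|n|] //=; by case: ifP.
move=> /out_live {out_live run_w}; case/andP: wfQ => fc le.
case/langTP: Tw => k [x [k' [fk L0x lk' ->]]].
case: l le lk' => [_ Kk'|/= e_gt0 ->].
  case: c; case: e => [|e] // _.
    (* With e = 0 the final [K] word is a complete block, so it is absorbed into the [L0] part. *)
    exists (IT f c0 1 false); first by rewrite /= fc.
    apply/langTP; exists k, (x ++ k'), [::]; split=> //.
      by apply: L0_cat => //; apply: K_L0.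
    by rewrite -!cats1 -!catA.
  (* The new b pairs with the last of the e.+1 letters a, enlarging the final [K] word by one letter
     at each end. *)
  exists (IT f c0 e true); first by rewrite /= fc.
  case/KP: Kk' => n ->; apply/langTP.
  exists k, x, (nseq n.+2 la ++ nseq n.+2 lb); split=> //; first exact: K_ab.
  rewrite (nseq_rcons n.+1 lb) -!rcons_cat; congr (rcons (_ ++ _ ++ _ ++ _) _).
  by rewrite !catA -!nseqD addSnnS.
rewrite cats0; case: c => _.
  exists (IT f c0 e.+1 false); first by rewrite /= fc.
  by apply/langTP; exists k, x, [::]; rewrite cats0 nseq_rcons -!rcons_cat.
case: e e_gt0 => // e _; exists (IT f c0 e true); first by rewrite /= fc.
apply/langTP; exists k, x, [:: la; lb]; split=> //; first exact: (K_ab 0).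
by rewrite -[_ :: _]/([:: la] ++ [:: lb]) nseq_rcons -!cats1 -!catA.
Qed.

Lemma live_lang w : contexts L0 w !=set0 -> exists2 Q, wf Q & lang Q w.
Proof.
elim/last_ind: w => [|w c IH] live_wc; first by exists (IA 0).
have [|Q wfQ Qw] := IH.
  by case: live_wc => -[u v]; rewrite contexts_L0 cat_rcons; exists (u, c :: v).
by apply: (lang_rcons wfQ Qw); apply: live_run.
Qed.

(** * Relative classes *)

Lemma h_nseq n c : h (nseq n.+1 c) = (Some c, Some c, false).
Proof.
elim: n => [|n IH]; first by case: c.
by rewrite -[nseq _ _]/([:: c] ++ nseq n.+1 c) h_cat IH; case: c {IH}.
Qed.

Lemma h_ab i j : h (nseq i.+1 la ++ nseq j.+1 lb) = (Some la, Some lb, false).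
Proof. by rewrite h_cat !h_nseq. Qed.

Lemma h_K k : K k -> h k = (Some la, Some lb, false).
Proof. by case/KP=> n ->; apply: h_ab. Qed.

Lemma h_L0 x : L0 x -> x = [::] \/ exists b, h x = (Some la, Some lb, b).
Proof.
case=> ws + <-; elim: ws => [|k ws IH] Kws; [by left | right => /=].
rewrite h_cat (h_K (Kws k _)); last by left.
have [w w_ws| ->|[b ->]] := IH; first by apply: Kws; right.
  by exists false.
by exists true; rewrite /= orbT.
Qed.

Definition h_lang (Q : class_index) : hval :=
  match Q with
  | IA r => h (nseq r la)
  | IB r => h (nseq r lb)
  | IC _ => (Some la, Some lb, false)
  | IT f _ _ l => (Some (if f then la else lb), Some (if l then lb else la), true)
  end.

Lemma h_L0_a_K x e l k : L0 x -> optK l k -> l || (0 < e) ->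
  exists b, h (x ++ nseq e la ++ k) = (Some la, Some (if l then lb else la), b).
Proof.
move=> L0x lk le.
have [b hak] : exists b,
    h (nseq e la ++ k) = (Some la, Some (if l then lb else la), b).
  rewrite h_cat; case: l lk le => [/h_K -> _|-> e_gt0]; exists false.
    by case: e => [|e]; rewrite ?h_nseq.
  by case: e e_gt0 => // e _; rewrite h_nseq.
rewrite h_cat hak; by case/h_L0: L0x => [-> |[b' ->]]; eexists.
Qed.

Lemma h_langP Q w : wf Q -> lang Q w -> h w = h_lang Q.
Proof.
case: Q => [r|r|d|f c e l] wfQ; [by move=> -> | by move=> -> | |].
  by case/clCP=> i [j [_ ->]]; apply: h_ab.
case/andP: wfQ => fc le /langTP[k [x [k' [fk L0x lk' ->]]]].
rewrite h_cat h_cat; have [b ->] := h_L0_a_K L0x lk' le.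
case: f fk fc => [/h_K -> _|->].
  by case: c => [|c]; rewrite ?h_nseq /= ?orbT.
by case: c => // c; rewrite h_nseq /= ?orbT.
Qed.

Lemma run_C d w y q : clC d w -> clC d y -> run q w = run q y.
Proof.
case/clCP=> i [j [eq_d ->]] /clCP[i' [j' [eq_d' ->]]].
case: q => [n|n|]; rewrite ?run_Dead //; last by rewrite /= !run_Dead.
rewrite !run_Up_ab; have -> : (j' < n + i'.+1) = (j < n + i.+1) by lia.
by case: ifP => // lt_j; congr owe; lia.
Qed.

Lemma lang_theta Q w y : wf Q -> lang Q w -> lang Q y -> theta L0 h w y.
Proof.
move=> wfQ Qw Qy; split; last by rewrite !(h_langP wfQ).
have eq_run q : run q w = run q y.
  case: Q wfQ Qw Qy => [r|r|d|f c e l] wfQ; do ?by move=> -> ->.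
    exact: run_C.
  by move=> Tw Ty; rewrite (run_T _ wfQ Tw) (run_T _ wfQ Ty).
by apply/seteqP; split=> -[u v] /contexts_L0/L0P Luv;
  apply/contexts_L0/L0P; rewrite !run_cat ?eq_run // -?eq_run in Luv *.
Qed.

Lemma syn_equiv_run u v w y : syn_equiv L0 w y ->
  run (Up 0) (u ++ w ++ v) = Up 0 -> run (Up 0) (u ++ y ++ v) = Up 0.
Proof.
move=> eq_wy /L0P Luv; apply/L0P.
by suff : contexts L0 y (u, v) by []; rewrite -eq_wy.
Qed.

(** * Contexts that separate the languages *)

Lemma run_C_context p q d w : clC d w ->
  run (Up 0) (nseq p la ++ w ++ nseq q lb) =
  if (Posz q - Posz p <= d)%R then owe (absz (d + Posz p - Posz q)%R) else Dead.
Proof.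
case/clCP=> i [j [eq_d ->]].
rewrite -catA -nseqD catA -nseqD addSn (run_Up_ab 0);
case: ifP => lt_j; case: ifP => le_d //; try lia.
by congr owe; lia.
Qed.

Lemma run_T_context f c e l w p q : wf (IT f c e l) -> lang (IT f c e l) w ->
  run (Up 0) (nseq p la ++ w ++ nseq q lb) = Up 0 <-> p = c /\ q = e.
Proof.
move=> wfT Tw; rewrite !run_cat run_Up_a add0n (run_T _ wfT Tw).
case: eqP => [->|neq_pc]; last by rewrite run_Dead; split=> [//|[]].
(* [Up e] is the value when nothing has started the descent: no final [K] word and no letter b in
   the context. *)
have -> : run (out e l) (nseq q lb) = if q <= e then
    (if l || (0 < q) then owe (e - q) else Up e) else Dead.
  case: l {wfT Tw}; first by rewrite run_owe_b.
  by case: q => [|q] //=; rewrite -run_owe_b; case: e.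
have [le_qe|lt_eq] := leqP q e; last by split=> [//|[_ eq_q]]; lia.
split=> [|[_ ->]].
  case: ifP => [_|]; first by case E: (e - q) => //; lia.
  by case: q le_qe => [|q] _; rewrite ?orbT // => _ [->].
by rewrite subnn; case: l {wfT Tw} => //; case: e {le_qe}.
Qed.

(** The value of h tells the families apart and gives f and l; the numerical parameters are
    recovered from a context of the form (a^p, b^q) that accepts one of the words. Languages are
    compared instead of indices because the unit class has two indices. *)
Lemma theta_lang_inj Q Q' w y : wf Q -> wf Q' -> lang Q w -> lang Q' y ->
  theta L0 h w y -> lang Q = lang Q'.
Proof.
move=> wfQ wfQ' Qw Qy [eq_syn]; rewrite (h_langP wfQ Qw) (h_langP wfQ' Qy).
move: wfQ wfQ' Qw Qy.
case: Q => [[|r]|[|r]|d|f c e l]; case: Q' => [[|r']|[|r']|d'|f' c' e' l'] //=;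
  rewrite ?h_nseq //.
- move=> _ _ wE yE _; have := @syn_equiv_run [::] (nseq r.+1 lb) _ _ eq_syn.
  rewrite wE yE !cat0s !(run_Up_ab 0) add0n ltnS leqnn subnn => /(_ erefl).
  case: ifP => // le_r; case E: (r'.+1 - r.+1) => // _.
  by rewrite (_ : r = r') //; lia.
- move=> _ _ wE yE _; have := @syn_equiv_run (nseq r.+1 la) [::] _ _ eq_syn.
  rewrite wE yE !cats0 !(run_Up_ab 0) add0n ltnS leqnn subnn => /(_ erefl).
  case: ifP => // le_r; case E: (r.+1 - r'.+1) => // _.
  by rewrite (_ : r = r') //; lia.
- move=> _ _ Cw Cy _; suff -> : d = d' by [].
  (* p and q are the negative and positive parts of d: this context exactly balances the a's and b's
     of a word of [clC d]. *)
  have [p [q eq_d]] : exists p q : nat, d = (Posz q - Posz p)%R.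
    by exists `|Order.min d 0%R|%N, `|Order.max d 0%R|%N; lia.
  have := @syn_equiv_run (nseq p la) (nseq q lb) _ _ eq_syn.
  rewrite (run_C_context _ _ Cw) (run_C_context _ _ Cy) ifT; last by lia.
  rewrite (_ : `|_|%N = 0); last by lia.
  move=> /(_ erefl); case: ifP => // le_d; case E: `|_|%N => // _; lia.
- move=> wfQ wfQ' Tw Ty [eq_f eq_l].
  have {}eq_f : f = f' by case: f f' eq_f {wfQ wfQ' Tw Ty} => -[].
  have {}eq_l : l = l' by case: l l' eq_l {wfQ wfQ' Tw Ty} => -[].
  have := @syn_equiv_run (nseq c la) (nseq e lb) _ _ eq_syn.
  rewrite (@run_T_context f c e l) // (@run_T_context f' c' e' l') //.
  by case=> // -> ->; rewrite eq_f eq_l.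
Qed.

Lemma lang_live Q w : wf Q -> lang Q w -> contexts L0 w !=set0.
Proof.
suff [u [v]] : exists u v, wf Q -> lang Q w -> run (Up 0) (u ++ w ++ v) = Up 0.
  by move=> Luv wfQ Qw; exists (u, v); apply/contexts_L0/L0P; apply: Luv.
case: Q => [r|r|d|f c e l].
- exists [::], (nseq r lb) => _ ->; case: r => // r.
  by rewrite run_Up_ab add0n ltnS leqnn subnn.
- exists (nseq r la), [::] => _ ->; case: r => // r.
  by rewrite cats0 run_Up_ab add0n ltnS leqnn subnn.
- exists (nseq `|Order.min d 0%R|%N la), (nseq `|Order.max d 0%R|%N lb) => _ Cw.
  by rewrite (run_C_context _ _ Cw) ifT; [rewrite (_ : `|_|%N = 0) //|]; lia.
- by exists (nseq c la), (nseq e lb) => wfT Tw; apply/(run_T_context _ _ wfT Tw).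
Qed.

Lemma class_of_lang Q w : wf Q -> lang Q w -> class_of L0 h w = lang Q.
Proof.
move=> wfQ Qw; apply/seteqP; split=> y; last exact: lang_theta wfQ Qw.
move=> th_wy; case: (th_wy) => eq_syn _.
have [Q' wfQ' Q'y] : exists2 Q', wf Q' & lang Q' y.
  by apply: live_lang; rewrite -eq_syn; apply: lang_live wfQ Qw.
by rewrite (theta_lang_inj wfQ wfQ' Qw Q'y th_wy).
Qed.

Lemma lang_nonempty Q : lang Q !=set0.
Proof.
case: Q => [r|r|d|f c e l]; [by eexists | by eexists | |].
  exists (nseq `|Order.max d 0%R|%N.+1 la ++ nseq `|Order.min d 0%R|%N.+1 lb).
  by apply/clCP; do 2!eexists; split; [|reflexivity]; lia.
have [k fk] := optK_nonempty f.
have [k' lk'] := optK_nonempty l.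
by eexists; apply/langTP; exists k, [::], k'; split=> //; apply: L0_nil.
Qed.

Definition nonunit (Q : class_index) : bool :=
  match Q with IA 0 | IB 0 => false | _ => true end.

Lemma lang_nil Q : wf Q -> lang Q [::] <-> ~~ nonunit Q.
Proof.
move=> wfQ; split=> [/(h_langP wfQ)|].
  by case: Q {wfQ} => [[|r]|[|r]|d|f c e l] //=; rewrite ?h_nseq.
by case: Q {wfQ} => [[|r]|[|r]|d|f c e l].
Qed.

Lemma unit_classE : unit_class L0 h = [set [::]].
Proof. exact: (@class_of_lang (IA 0)). Qed.

Lemma lang_unit Q : wf Q -> lang Q = unit_class L0 h <-> ~~ nonunit Q.
Proof.
move=> wfQ; rewrite unit_classE; split=> [eq_Q|].
  by apply/(lang_nil wfQ); rewrite eq_Q.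
by case: Q {wfQ} => [[|r]|[|r]|d|f c e l].
Qed.

Lemma live_nonunit_classP X : live_nonunit_class L0 h X <->
  exists Q, [/\ wf Q, nonunit Q & X = lang Q].
Proof.
split=> [[[x ->] live_x neq_1]|[Q [wfQ nuQ ->]]].
  have [Q wfQ Qx] : exists2 Q, wf Q & lang Q x.
    by apply: live_lang; apply: live_x.
  exists Q; split=> //; last exact: class_of_lang.
  apply/negPn/negP => /(lang_unit wfQ) eq_1.
  by apply: neq_1; rewrite -eq_1; apply: class_of_lang.
have [w Qw] := lang_nonempty Q; split.
- by exists w; rewrite (class_of_lang wfQ Qw).
- by move=> x; apply: lang_live.
- by move=> /(lang_unit wfQ); rewrite nuQ.
Qed.

(** * Factorizations *)

(** The prime containing [L0] also swallows its neighbour on each side: on the left a [K] word if f,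
    otherwise one b; on the right one a, or the [K] word when e = 0. *)
Definition tail_fac (f : bool) (e : nat) (l : bool) : seq (set word) :=
  if e is e'.+1 then
    (if f then pF else pD) :: nseq e' pA ++ (if l then [:: pC] else [::])
  else [:: if f then pG else pE].

Definition fac (Q : class_index) : seq (set word) :=
  match Q with
  | IA r => facA r
  | IB r => facB r
  | IC d => facC d
  | IT f c e l =>
    if c is c'.+1 then
      (if f then [:: pC] else [::]) ++ nseq c' pB ++ tail_fac false e l
    else tail_fac true e l
  end.

Lemma fac_X c e : 0 < c -> 0 < e -> fac (IT false c e false) = facX c e.
Proof. by case: c e => [|c] [|e]; rewrite //= cats0. Qed.

Lemma fac_Y c e : 0 < c -> fac (IT false c e true) = facY c e.
Proof. by case: c e => [|c] [|e]. Qed.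

Lemma fac_Z c e : 0 < e -> fac (IT true c e false) = facZ c e.
Proof. by case: c e => [|c] [|e]; rewrite //= cats0. Qed.

Lemma fac_W c e : fac (IT true c e true) = facW c e.
Proof. by case: c e => [|c] [|e]. Qed.

Lemma lang_X c e : lang (IT false c e false) = clX c e.
Proof. by rewrite /= lprod1l lprod1r. Qed.

Lemma lang_Y c e : lang (IT false c e true) = clY c e.
Proof. by rewrite /= lprod1l. Qed.

Lemma lang_Z c e : lang (IT true c e false) = clZ c e.
Proof. by rewrite /= lprod1r. Qed.

Lemma facC_pos n : facC (Posz n) = nseq n pA ++ [:: pC].
Proof. by case: n. Qed.

Lemma facC_neg n : facC (- Posz n)%R = pC :: nseq n pB.
Proof. by case: n. Qed.

Lemma int_pos_neg (d : int) :
  (exists n : nat, d = Posz n) \/ (exists n : nat, d = (- Posz n.+1)%R).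
Proof. by case: d => n; [left | right]; exists n. Qed.

Lemma clC0 : clC 0 = K.
Proof.
apply/seteqP; split=> w; first by case/clC_pos=> j ->; apply: K_ab.
by case/KP=> n ->; apply/clC_pos; exists n.
Qed.

Lemma clC_apow n : clC (Posz n) = apow n ** K.
Proof.
apply/seteqP; split=> w.
  by case/clC_pos=> j ->; rewrite nseqD -catA; apply: lprod_cat (K_ab j).
case/lprodP=> _ [_ [-> /KP[j ->] ->]]; apply/clC_pos; exists j.
by rewrite nseqD -catA.
Qed.

Lemma clC_bpow n : clC (- Posz n)%R = K ** bpow n.
Proof.
apply/seteqP; split=> w.
  by case/clC_neg=> i ->; rewrite addnC nseqD catA; apply: lprod_cat (K_ab i) _.
case/lprodP=> _ [_ [/KP[i ->] -> ->]]; apply/clC_neg; exists i.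
by rewrite addnC nseqD -catA.
Qed.

Lemma lprods_tail_fac f e l : l || (0 < e) ->
  lprods (tail_fac f e l) = (if f then K else pB) ** L0 ** apow e ** optK l.
Proof.
case: e => [|e]; first by case: l => // _; rewrite /= !lprod1r; case: f.
move=> _; rewrite /tail_fac lprods_cons lprods_cat lprods_nseq.
have -> : lprods (if l then [:: pC] else [::]) = optK l.
  by case: l => //; apply: lprod1r.
have -> : apow e.+1 = pA ** apow e by rewrite [RHS](pow_add 1).
by case: f; rewrite !lprodA.
Qed.

Lemma lprods_fac Q : wf Q -> lprods (fac Q) = lang Q.
Proof.
case: Q => [r|r|d|f c e l] wfQ; [exact: lprods_nseq | exact: lprods_nseq | |].
  change (lprods (facC d) = clC d); case: (int_pos_neg d) => -[n ->].
    by rewrite facC_pos lprods_cat lprods_nseq lprods1 clC_apow.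
  rewrite facC_neg -cat1s lprods_cat lprods1 lprods_nseq.
  by rewrite clC_bpow.
case/andP: wfQ => fc le; case: c fc => [|c] fc.
  by rewrite lprods_tail_fac //; case: f fc => //=; rewrite lprod1r.
rewrite /= !lprods_cat lprods_tail_fac // lprods_nseq.
have -> : lprods (if f then [:: pC] else [::]) = optK f.
  by case: f {fc}; rewrite /= ?lprod1r.
have -> : bpow c.+1 = bpow c ** pB by rewrite [RHS](pow_add c 1) addn1.
by rewrite !lprodA.
Qed.

(** * Candidate primes and constancy of h *)

Definition is_prime (P : set word) : Prop :=
  P = pA \/ P = pB \/ P = pC \/ P = pD \/ P = pE \/ P = pF \/ P = pG.

Lemma is_prime_lang P : is_prime P ->
  exists Q, [/\ wf Q, nonunit Q, lang Q = P & fac Q = [:: P]].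
Proof.
move=> [|[|[|[|[|[|]]]]]] ->.
- by exists (IA 1).
- by exists (IB 1).
- by exists (IC 0); split=> //; apply: clC0.
- by exists (IT false 1 1 false); rewrite /= lprod1l lprod1r.
- by exists (IT false 1 0 true); rewrite /= lprod1l lprod1r.
- by exists (IT true 0 1 false); rewrite /= !lprod1r.
- by exists (IT true 0 0 true); rewrite /= !lprod1r.
Qed.

Lemma is_prime_fac Q P : List.In P (fac Q) -> is_prime P.
Proof.
have in_nseq n p : List.In P (nseq n p) -> P = p.
  by elim: n => //= n IH [].
have in_tail f e l : List.In P (tail_fac f e l) -> is_prime P.
  case: e => [|e] /=; first by rewrite /is_prime; case: f => -[<-|//]; tauto.
  case=> [<-|/(@List.in_app_or _ _ _ _)[/in_nseq ->|]].
  - by rewrite /is_prime; case: f; tauto.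
  - by left.
  - by case: l => // -[<-|//]; rewrite /is_prime; tauto.
case: Q => [r|r|d|f c e l].
- by move/in_nseq; left.
- by move/in_nseq; right; left.
- case: (int_pos_neg d) => -[n ->].
    rewrite [fac _]facC_pos => /(@List.in_app_or _ _ _ _)[/in_nseq|[<-|//]].
      by left.
    by right; right; left.
  rewrite [fac _]facC_neg => /(@List.in_inv _ _ _ _)[<-|/in_nseq ->].
    by right; right; left.
  by right; left.
case: c => [|c] /=; first exact: in_tail.
case/(@List.in_app_or _ _ _ _).
  by case: f => // -[<-|//]; right; right; left.
case/(@List.in_app_or _ _ _ _); first by move/in_nseq; right; left.
exact: in_tail.
Qed.

(** This is all that the cancellation lemmas assume of the product R of the remaining factors, which
    is not yet known to be a class. *)
Definition h_constant (R : set word) : Prop :=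
  forall x y, R x -> R y -> h x = h y.

Lemma lprods_h_constant s :
  (forall P, List.In P s -> is_prime P) -> h_constant (lprods s).
Proof.
elim: s => [|P s IH] prime_s; first by move=> x y -> ->.
have [|Q [wfQ _ QP _]] := @is_prime_lang P; first by apply: prime_s; left.
move=> _ _ /lprodP[p [x [+ sx ->]]] /lprodP[p' [y [+ sy ->]]]; rewrite -QP.
move=> Pp Pp'; rewrite !h_cat (h_langP wfQ Pp) (h_langP wfQ Pp').
by rewrite (IH _ x y) // => P' s_P'; apply: prime_s; right.
Qed.

(** * Cancelling a candidate prime on the left *)

Lemma nseq_cat_inj c m n (y z : word) : ohead y <> Some c -> ohead z <> Some c ->
  nseq m c ++ y = nseq n c ++ z -> m = n /\ y = z.
Proof.
move=> yc zc; elim: m n => [|m IH] [|n] //=.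
- by move=> def_y; case: yc; rewrite def_y.
- by move=> def_z; case: zc; rewrite -def_z.
by case=> /IH[-> ->].
Qed.

Lemma K_cat_inj n m j (y z : word) : ohead z <> Some lb ->
    nseq n.+1 la ++ nseq n.+1 lb ++ y = nseq m.+1 la ++ nseq j.+1 lb ++ z ->
  n = m /\ (nseq n.+1 lb ++ y = nseq j.+1 lb ++ z).
Proof. by move=> zb /nseq_cat_inj[] // [->]. Qed.

Lemma h_a_K e l k : optK l k -> l || (0 < e) ->
  h (nseq e la ++ k) = (Some la, Some (if l then lb else la), false).
Proof.
rewrite h_cat; case: l => [/h_K -> _|-> e_gt0].
  by case: e => [|e]; rewrite ?h_nseq.
by case: e e_gt0 => // e _; rewrite h_nseq.
Qed.

(** A nonempty word of [L0] ends in b, so the a that follows would create ba. *)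
Lemma L0_ba_free x t : L0 x -> ohead t = Some la -> has_ba (x ++ t) = false ->
  x = [::].
Proof.
move=> L0x ta; case/h_L0: L0x => // -[b [_ def_l _]].
by rewrite has_ba_cat def_l /fst_letter ta !orbT.
Qed.

Lemma ohead_L0_cat x t : L0 x -> ohead t = Some la -> ohead (x ++ t) = Some la.
Proof. by case/L0_inv=> [-> //|[_ [y [/KP[n ->] _ ->]]]]. Qed.

(** Only classes whose words all begin with a are possible. Among them, those containing words with
    exactly one leading a and words with more would leave both initial letters in R. *)
Lemma step_A R Q : h_constant R -> wf Q -> pA ** R = lang Q ->
  exists Q', [/\ wf Q', R = lang Q' & fac Q = pA :: fac Q'].
Proof.
move=> hR wfQ eq_Q.
have memR r : R r <-> lang Q (la :: r).
  rewrite -eq_Q; split=> [Rr|/lprodP[_ [r' [-> Rr' [->]]]] //].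
  exact: (@lprod_cat _ pA _ [:: la]).
have headQ w : lang Q w -> ohead w = Some la.
  by rewrite -eq_Q => /lprodP[_ [r [-> _ ->]]].
have no_mix r r' : R (la :: r) -> R (lb :: r') -> False.
  by move=> Ra Rb; have := hR _ _ Ra Rb.
case: Q wfQ {eq_Q} memR headQ => [[|r]|[|r]|d|f c e l] wfQ memR headQ.
- by have := headQ [::] erefl.
- exists (IA r); split=> //; apply/seteqP.
  by split=> x; [case/memR | move=> ->; apply/memR].
- by have := headQ [::] erefl.
- by have := headQ (nseq r.+1 lb) erefl.
(* Zero goes with the negative indices: from there on down, one and two leading a's both occur. *)
- have [[n def_d]|[n def_d]] : (exists n : nat, d = Posz n.+1) \/
      (exists n : nat, d = (- Posz n)%R).
    by case: d {memR headQ wfQ} => [[|n]|n]; [right; exists 0 | left; exists n |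
      right; exists n.+1].
    exists (IC n); split=> //; last by rewrite /= def_d !facC_pos.
    apply/seteqP; split=> x; rewrite memR def_d /= !clC_pos.
      by case=> j [->]; exists j.
    by case=> j ->; exists j.
  exfalso; apply: (no_mix (nseq n.+2 lb) (nseq n lb)).
    by apply/memR; rewrite def_d; apply/clC_neg; exists 1; rewrite addn2.
  by apply/memR; rewrite def_d; apply/clC_neg; exists 0; rewrite addn1.
- have [w Tw] := lang_nonempty (IT f c e l).
  have := headQ _ Tw; case/langTP: Tw => k [x [k' [fk L0x lk' ->]]].
  case: f wfQ memR {headQ} fk => [|] wfQ memR fk; last first.
    by rewrite fk; case: c wfQ {memR} => // c _.
  move=> _; set t := nseq c lb ++ x ++ nseq e la ++ k'.
  exfalso; apply: (no_mix (lb :: lb :: t) t); apply/memR/langTP.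
    by exists [:: la; la; lb; lb], x, k'; split=> //; apply: (K_ab 1).
  by exists [:: la; lb], x, k'; split=> //; apply: (K_ab 0).
Qed.

Lemma step_B R Q : h_constant R -> wf Q -> pB ** R = lang Q ->
  exists Q', [/\ wf Q', R = lang Q' & fac Q = pB :: fac Q'].
Proof.
move=> hR wfQ eq_Q.
have memR r : R r <-> lang Q (lb :: r).
  rewrite -eq_Q; split=> [Rr|/lprodP[_ [r' [-> Rr' [->]]]] //].
  exact: (@lprod_cat _ pB _ [:: lb]).
have headQ w : lang Q w -> ohead w = Some lb.
  by rewrite -eq_Q => /lprodP[_ [r [-> _ ->]]].
have headh w : lang Q w -> (h_lang Q).1.1 = Some lb.
  by move=> Qw; rewrite -(h_langP wfQ Qw) -(headQ w).
case: Q wfQ {eq_Q} memR headQ headh => [r|[|r]|d|f c e l] wfQ memR headQ headh.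
- by have := headQ (nseq r la) erefl; case: r {wfQ memR headQ headh}.
- by have := headQ [::] erefl.
- exists (IB r); split=> //; apply/seteqP.
  by split=> x; [case/memR | move=> ->; apply/memR].
- by have [w /headh] := lang_nonempty (IC d).
have [w Tw] := lang_nonempty (IT f c e l).
have := headh _ Tw; case: f wfQ memR Tw {headQ headh} => // wfQ memR Tw _.
case/andP: (wfQ); case: c wfQ memR Tw => [//|[|c]] wfQ memR Tw _ le; last first.
  exists (IT false c.+1 e l); split=> //; apply/seteqP; split=> y.
    move/memR/langTP => [_ [x [k [-> L0x lk [->]]]]].
    by apply/langTP; exists [::], x, k.
  move/langTP => [_ [x [k [-> L0x lk ->]]]]; apply/memR/langTP.
  by exists [::], x, k.
(* When c = 1, removing the only b exposes [L0]: filling it with the empty word and with ab gives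
   two words of R, just one of which contains ba. *)
exfalso; case/langTP: Tw => _ [_ [k [_ _ lk _]]].
have Rak : R (nseq e la ++ k).
  by apply/memR/langTP; exists [::], [::], k; split=> //; apply: L0_nil.
have Rabak : R ([:: la; lb] ++ nseq e la ++ k).
  apply/memR/langTP; exists [::], [:: la; lb], k; split=> //.
  by apply: K_L0; apply: (K_ab 0).
have := hR _ _ Rak Rabak.
by rewrite [RHS]h_cat (h_a_K lk le) (h_K (K_ab 0)).
Qed.

Lemma h_nil_inv x : h x = h [::] -> x = [::].
Proof. by case: x. Qed.

Lemma h_constant_nil R : h_constant R -> R [::] -> R = [set [::]].
Proof.
move=> hR R0; apply/seteqP; split=> x; last by move=> ->.
by move=> Rx; apply: h_nil_inv; apply: hR.
Qed.

Lemma mem_nseq_cat (c : letter) n (y : word) : c \in nseq n.+1 c ++ y.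
Proof. by rewrite mem_cat mem_nseq eqxx. Qed.

(** The leading a's determine the [K] word to be removed, so testing on words with a single leading
    a forces it to be ab and shows what R must contain. *)
Lemma step_C R Q : h_constant R -> wf Q -> pC ** R = lang Q ->
  exists Q', [/\ wf Q', R = lang Q' & fac Q = pC :: fac Q'].
Proof.
move=> hR wfQ eq_Q.
have QKR n r : R r -> lang Q (nseq n.+1 la ++ nseq n.+1 lb ++ r).
  by move=> Rr; rewrite -eq_Q catA; apply: lprod_cat => //; apply: K_ab.
have KRQ w : lang Q w ->
    exists n r, R r /\ w = nseq n.+1 la ++ nseq n.+1 lb ++ r.
  by rewrite -eq_Q => /lprodP[_ [r [/KP[n ->] Rr ->]]]; exists n, r; rewrite catA.
case: Q wfQ {eq_Q} QKR KRQ => [r|r|d|f c e l] wfQ QKR KRQ.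
- have [n [s [_ eq_r]]] := KRQ (nseq r la) erefl.
  have : lb \in nseq r la by rewrite eq_r mem_cat mem_nseq_cat orbT.
  by rewrite mem_nseq andbF.
- have [n [s [_ eq_r]]] := KRQ (nseq r lb) erefl.
  have : la \in nseq r lb by rewrite eq_r mem_nseq_cat.
  by rewrite mem_nseq andbF.
- case: (int_pos_neg d) => -[n def_d]; rewrite def_d in wfQ QKR KRQ *.
    (* This word has a single b, so the [K] factor can only be ab; this forces n = 0 and puts the
       empty word in R. *)
    have [|m [r [Rr]]] := KRQ (nseq (n + 1) la ++ nseq 1 lb).
      by apply/clC_pos; exists 0.
    rewrite -[nseq 1 lb]cats0 addn1 => /esym/K_cat_inj[] // def_m.
    case: m def_m => // <- [def_r].
    exists (IA 0); split=> //.
    by apply: h_constant_nil; rewrite -?def_r.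
  have [|m [r [Rr]]] := KRQ (nseq 1 la ++ nseq (n.+1 + 1) lb).
    by apply/clC_neg; exists 0.
  rewrite -[nseq (_ + _) lb]cats0 addn1 => /esym/K_cat_inj[] //.
  move=> ->; rewrite cats0 => -[def_r].
  exists (IB n.+1); split=> //.
  apply/seteqP; split=> x; last by move=> ->; rewrite -[nseq _ _]def_r.
  move=> Rx; have /clC_neg[i] := QKR 0 x Rx.
  rewrite -[nseq (_ + i.+1) lb]cats0 addnS => /K_cat_inj[] // <-.
  by rewrite cats0 addn0 => -[].
case: f wfQ QKR KRQ => wfQ QKR KRQ; last first.
  have [w Tw] := lang_nonempty (IT false c e l).
  have [n [r [_ def_w]]] := KRQ w Tw.
  by have := h_langP wfQ Tw; rewrite def_w.
case/andP: (wfQ) => _ le.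
have RT x k : L0 x -> optK l k -> R (nseq c lb ++ x ++ nseq e la ++ k).
  move=> L0x lk; set t := x ++ _; have [|n [r [Rr]]] :=
      KRQ (nseq 1 la ++ nseq 1 lb ++ nseq c lb ++ t).
    by apply/langTP; exists [:: la; lb], x, k; split=> //; apply: (K_ab 0).
  rewrite (catA (nseq 1 lb)) -nseqD => /esym/K_cat_inj[|-> [<-] //].
  by have [b [def_t _ _]] := h_L0_a_K L0x lk le; rewrite -/(fst_letter t) def_t.
have TR y : R y -> lang (IT false c e l) y.
  move=> /(QKR 0)/langTP[_ [x [k [/KP[n ->] L0x lk]]]].
  rewrite -catA => /nseq_cat_inj[] // [<-] [->].
  by apply/langTP; exists [::], x, k.
case: c wfQ {QKR KRQ} RT TR => [|c] wfQ RT TR; last first.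
  exists (IT false c.+1 e l); split=> //; apply/seteqP; split=> y; first exact: TR.
  by case/langTP => _ [x [k [-> L0x lk ->]]]; apply: RT.
(* When c = 0 the rest begins with [L0], and its words empty and ab again give different values of h
   in R. *)
have [k lk] := optK_nonempty l.
have Rak : R (nseq e la ++ k) := RT [::] k L0_nil lk.
have Rabak : R ((nseq 1 la ++ nseq 1 lb) ++ nseq e la ++ k).
  exact: (RT _ k (K_L0 (K_ab 0)) lk).
have := hR _ _ Rak Rabak.
by rewrite [RHS]h_cat (h_a_K lk le) (h_K (K_ab 0)).
Qed.

(** Since t and t' begin with a, the first maximal run of b's ends at the same place on both sides;
    its length, compared with the run of a's before it if f, gives c. *)
Lemma head_block_inj (f : bool) c k1 k2 t t' : (if f then K else pB) k1 -> optK f k2 ->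
    ohead t = Some la -> ohead t' = Some la ->
    k1 ++ t = k2 ++ nseq c lb ++ t' ->
  c = (if f then 0 else 1) /\ t = t'.
Proof.
move=> fk1 fk2 ta ta'; have [tb tb'] : ohead t <> Some lb /\ ohead t' <> Some lb.
  by rewrite ta ta'.
case: f fk1 fk2 => [/KP[n ->] /KP[m ->]|-> ->]; last first.
  by move=> /(@nseq_cat_inj lb 1 c)[] // <-.
rewrite -!catA => /nseq_cat_inj[] // [->].
rewrite (catA (nseq _ lb) (nseq c lb)) -nseqD => /nseq_cat_inj[] //.
by move=> eq_n ->; split=> //; lia.
Qed.

(** The flags f and l0 select one of [pD], [pE], [pF], [pG]. After the left block is cancelled,
    words free of ba make the [L0] parts empty, and what remains is to compare a^e and the optional
    [K] word with the right end of the prime followed by R. *)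
Lemma step_T (f l0 : bool) R Q : h_constant R -> wf Q ->
    (if f then K else pB) ** L0 ** (if l0 then K else pA) ** R = lang Q ->
  exists Q', [/\ wf Q', R = lang Q' &
    fac Q = (if l0 then if f then pG else pE else if f then pF else pD) :: fac Q'].
Proof.
move=> hR wfQ; rewrite -!lprodA => eq_Q.
have QR k x z r : (if f then K else pB) k -> L0 x -> (if l0 then K else pA) z ->
    R r -> lang Q (k ++ x ++ z ++ r).
  by move=> ? ? ? ?; rewrite -eq_Q; do 3!apply: lprod_cat => //.
have RQ w : lang Q w -> exists k x z r, [/\ (if f then K else pB) k, L0 x,
    (if l0 then K else pA) z, R r & w = k ++ x ++ z ++ r].
  rewrite -eq_Q => /lprodP[k [_ [fk /lprodP[x [y [L0x Rw ->]]] ->]]].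
  by case/lprodP: Rw => z [r [lz Rr ->]]; exists k, x, z, r.
have head_zr z r x : L0 x -> (if l0 then K else pA) z -> ohead (x ++ z ++ r) = Some la.
  move=> L0x lz; apply: ohead_L0_cat => //.
  by case: l0 lz {eq_Q QR RQ} => [/KP[n ->]|->].
(* The left block ends in b and is followed by a, so ba occurs and only [IT] can match. *)
have hQ : (h_lang Q).1.1 = Some (if f then la else lb) /\ (h_lang Q).2.
  have [w Qw] := lang_nonempty Q; rewrite -(h_langP wfQ Qw).
  have [k [x [z [r [fk L0x lz Rr ->]]]]] := RQ w Qw.
  have := head_zr z r x L0x lz; set t := x ++ _ => ta; rewrite h_cat.
  have -> : h t = (Some la, lst_letter t, has_ba t) by rewrite -ta.
  by case: f fk {eq_Q QR RQ} => [/h_K|] -> /=; rewrite ?orbT.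
case: Q wfQ {eq_Q} QR RQ hQ => [r|r|d|f' c e l] wfQ QR RQ [].
- by case: r {wfQ QR RQ} => // r; rewrite [h_lang _]h_nseq.
- by case: r {wfQ QR RQ} => // r; rewrite [h_lang _]h_nseq.
- by [].
move=> eq_f _; have {eq_f} def_f : f' = f by case: (f) (f') eq_f => -[].
subst f'; case/andP: (wfQ) => _ le.
have head_T x k : L0 x -> optK l k -> ohead (x ++ nseq e la ++ k) = Some la.
  by move=> L0x lk; have [b [def_t _ _]] := h_L0_a_K L0x lk le.
have TR x k : L0 x -> optK l k -> c = (if f then 0 else 1) /\
    exists y z r, [/\ L0 y, (if l0 then K else pA) z, R r &
      x ++ nseq e la ++ k = y ++ z ++ r].
  move=> L0x lk; have [k0 fk0] := optK_nonempty f.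
  have [|k1 [y [z [r [fk1 L0y lz Rr]]]]] :=
      RQ (k0 ++ nseq c lb ++ x ++ nseq e la ++ k).
    by apply/langTP; exists k0, x, k.
  move/esym/(head_block_inj fk1 fk0 (head_zr _ _ _ L0y lz) (head_T _ _ L0x lk)).
  by case=> -> <-; split=> //; exists y, z, r.
have RT y z r : L0 y -> (if l0 then K else pA) z -> R r ->
    exists x k, [/\ L0 x, optK l k & y ++ z ++ r = x ++ nseq e la ++ k].
  move=> L0y lz Rr; have [k fk] : (if f then K else pB) !=set0.
    by case: (f); eexists; [apply: (K_ab 0) | reflexivity].
  have /langTP[k2 [x [k' [fk2 L0x lk']]]] := QR k y z r fk L0y lz Rr.
  move/(head_block_inj fk fk2 (head_zr _ _ _ L0y lz) (head_T _ _ L0x lk')).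
  by case=> _ ->; exists x, k'.
have [k0 lk0] := optK_nonempty l.
have [def_c _] := TR [::] k0 L0_nil lk0.
have -> : fac (IT f c e l) = tail_fac f e l.
  by rewrite def_c; case: (f) wfQ.
(* The word a^e k has no ba, so the [L0] part y of its decomposition is empty. *)
have {}TR k : optK l k -> exists z r, [/\ (if l0 then K else pA) z, R r &
    nseq e la ++ k = z ++ r].
  move=> lk; have [_ [y [z [r [L0y lz Rr eq_t]]]]] := TR [::] k L0_nil lk.
  exists z, r; split=> //; rewrite -[LHS]cat0s eq_t.
  rewrite (@L0_ba_free y (z ++ r) L0y) //; first exact: (head_zr z r [::] L0_nil lz).
  by rewrite -eq_t cat0s; have [] := h_a_K lk le.
case: l0 TR RT {QR RQ head_zr} => TR RT.
  case: l le lk0 {RT wfQ head_T} TR => [_ _|e_gt0 k0E] TR; last first.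
    have [_ [r [/KP[n ->] _ def_e]]] := TR [::] erefl.
    have : lb \in nseq e la ++ [::].
      by rewrite def_e !mem_cat !mem_nseq eqxx orbT.
    by rewrite cats0 mem_nseq andbF.
  (* The only b of a^e ab must close the [K] word z, which is therefore ab; hence e = 0 and r is
     empty. *)
  have [_ [r [/KP[n ->] Rr]]] := TR _ (K_ab 0).
  rewrite catA -(nseqD e 1) addn1 -(cats0 (nseq 1 lb)) -catA.
  move=> /esym/K_cat_inj[] // -> [def_r].
  have e0 : e = 0 by case: (e) def_r.
  rewrite e0 /= in def_r *; exists (IA 0); split=> //.
  by apply: h_constant_nil => //; rewrite -def_r.
case: e le {head_T wfQ} TR RT => [|e] le TR RT.
  case: l le {lk0 RT} TR => // _ TR.
  (* Removing the a from ab and from aabb would put both b and abb in R. *)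
  have [_ [r [-> Rr [def_r]]]] := TR _ (K_ab 0).
  have [_ [r' [-> Rr' [def_r']]]] := TR _ (K_ab 1).
  by have := hR _ _ Rr Rr'; rewrite -def_r -def_r'.
have {}TR k : optK l k -> R (nseq e la ++ k).
  by case/TR=> _ [r [-> Rr [->]]].
have {}RT r : R r -> exists2 k, optK l k & r = nseq e la ++ k.
  move=> Rr; have [x [k [L0x lk eq_r]]] := RT [::] [:: la] r L0_nil erefl Rr.
  (* By constancy, r has the same h as the word a^e k of R, so la :: r contains no ba and x must be
     empty. *)
  have x0 : x = [::].
    apply: (@L0_ba_free x (nseq e.+1 la ++ k)) => //.
    rewrite -eq_r /= -[has_ba _]/(h ([:: la] ++ r)).2 h_cat (hR _ _ Rr (TR _ lk)).
    by rewrite -h_cat -[_ ++ _]/(nseq e.+1 la ++ k) (h_a_K lk le).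
  by exists k => //; move: eq_r; rewrite x0 => -[].
exists (if l then IC e else IA e); case: l le lk0 TR RT => _ _ TR RT; split=> //.
- rewrite [lang _]clC_apow; apply/seteqP; split=> y.
    by case/RT=> k Kk ->; apply: lprod_cat.
  by case/lprodP=> _ [k [-> Kk ->]]; apply: TR.
- by rewrite [fac (IC e)]facC_pos.
- apply/seteqP; split=> y; first by case/RT=> _ -> ->; rewrite cats0.
  by move=> ->; rewrite -[nseq e la]cats0; apply: TR.
- by rewrite /= cats0.
Qed.

(** That R is a class is a conclusion here, which is what lets an induction strip the factors of a
    product one by one. *)
Lemma prime_step P R Q : is_prime P -> h_constant R -> wf Q -> P ** R = lang Q ->
  exists Q', [/\ wf Q', R = lang Q' & fac Q = P :: fac Q'].
Proof.
move=> [|[|[|[|[|[|]]]]]] ->.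
- exact: step_A.
- exact: step_B.
- exact: step_C.
- exact: (@step_T false false).
- exact: (@step_T false true).
- exact: (@step_T true false).
- exact: (@step_T true true).
Qed.

(** * Uniqueness and the relative primes *)

Lemma fac_unique s Q : (forall P, List.In P s -> is_prime P) -> wf Q ->
  lprods s = lang Q -> s = fac Q.
Proof.
elim: s Q => [|P s IH] Q prime_s wfQ eq_Q.
  have : lang Q [::] by rewrite -eq_Q.
  by move/(lang_nil wfQ); case: Q {wfQ eq_Q} => [[|r]|[|r]|d|f c e l].
have prime_s' P' : List.In P' s -> is_prime P' by move=> ?; apply: prime_s; right.
have [||Q' [wfQ' eq_Q' ->]] := prime_step _ _ wfQ eq_Q.
- by apply: prime_s; left.
- exact: lprods_h_constant.
by rewrite -(IH Q').
Qed.

Lemma fac_nil Q : nonunit Q -> fac Q <> [::].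
Proof.
case: Q => [[|r]|[|r]|d|f [|c] [|e] l] //= _.
  by case: (int_pos_neg d) => -[n ->]; rewrite ?facC_pos ?facC_neg //; case: n.
all: by case: f => //; case: c.
Qed.

(** Cancelling the first prime from the product of [fac Q] yields the index of the tail, with no
    inspection of the shape of [fac]. *)
Lemma fac_behead Q P s : wf Q -> fac Q = P :: s -> exists2 Q', wf Q' & s = fac Q'.
Proof.
move=> wfQ def_fac.
have prime_s P' : List.In P' (P :: s) -> is_prime P'.
  by rewrite -def_fac; apply: is_prime_fac.
have [|||Q' [wfQ' _]] := @prime_step P (lprods s) Q _ _ wfQ.
- by apply: prime_s; left.
- by apply: lprods_h_constant => P' ?; apply: prime_s; right.
- by rewrite -lprods_cons -def_fac lprods_fac.
by rewrite def_fac => -[->]; exists Q'.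
Qed.

Lemma relative_class_lang X x y z : relative_class L0 h X -> X x ->
  contexts L0 (y ++ x ++ z) !=set0 -> exists2 Q, wf Q & X = lang Q.
Proof.
move=> [x0 ->] Xx [[u v] /contexts_L0 Luv].
have live_x0 : contexts L0 x0 !=set0.
  by case: Xx => -> _; exists (u ++ y, z ++ v); rewrite contexts_L0 -!catA in Luv *.
have [Q wfQ Qx0] := live_lang live_x0.
by exists Q => //; apply: class_of_lang.
Qed.

(** A prime class is its first listed factor times a class; the former is not the unit, so the
    latter is. Conversely, the listed factorizations of X and Y concatenate to one of P, which has
    length one. *)
Lemma relative_primeP P : relative_prime L0 h P <-> is_prime P.
Proof.
split.
  case=> /live_nonunit_classP[Q [wfQ nuQ ->]] irr_Q.
  case def_fac: (fac Q) => [|P' s]; first by case: (fac_nil nuQ).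
  have P'_prime : is_prime P' by apply: (@is_prime_fac Q); rewrite def_fac; left.
  have [Q' wfQ' def_s] := fac_behead wfQ def_fac.
  have [Q1 [wfQ1 nuQ1 eq_Q1 _]] := is_prime_lang P'_prime.
  have eq_Q : lang Q = P' ** lang Q'.
    by rewrite -(lprods_fac wfQ) def_fac def_s -(lprods_fac wfQ').
  have relative Q2 : wf Q2 -> relative_class L0 h (lang Q2).
    move=> wfQ2; have [w Qw] := lang_nonempty Q2.
    by exists w; rewrite (class_of_lang wfQ2 Qw).
  have classP' : relative_class L0 h P' by rewrite -eq_Q1; apply: relative.
  case: (irr_Q _ _ classP' (relative _ wfQ') eq_Q).
    by rewrite -eq_Q1 => /(lang_unit wfQ1); rewrite nuQ1.
  by rewrite eq_Q unit_classE => ->; rewrite lprod1r.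
move=> P_prime; have [Q [wfQ nuQ QP fac_Q]] := is_prime_lang P_prime.
split; first by apply/live_nonunit_classP; exists Q.
move=> X Y clX clY eq_P.
(* X and Y are arbitrary relative classes; a live word of their product shows that both are live,
   hence among the listed languages. *)
have [w Pw] := lang_nonempty Q; have live_w := lang_live wfQ Pw.
move: Pw live_w; rewrite QP eq_P => /lprodP[x [y [Xx Yy ->]]] live_w.
have [Q1 wfQ1 eq_Q1] : exists2 Q1, wf Q1 & X = lang Q1.
  by apply: (@relative_class_lang X x [::] y).
have [Q2 wfQ2 eq_Q2] : exists2 Q2, wf Q2 & Y = lang Q2.
  by apply: (@relative_class_lang Y y x [::]); rewrite // cats0.
rewrite eq_Q1 eq_Q2 in eq_P *.
have := @fac_unique (fac Q1 ++ fac Q2) Q.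
rewrite fac_Q lprods_cat !lprods_fac // QP eq_P => fac_eq.
have {fac_eq} : fac Q1 ++ fac Q2 = [:: P].
  rewrite -eq_P in fac_eq; rewrite fac_eq // => P'.
  by case/(@List.in_app_or _ _ _ _); apply: is_prime_fac.
have [nu1|u1] := boolP (nonunit Q1); last by left; apply/lang_unit.
have [nu2|u2] := boolP (nonunit Q2); last by right; apply/lang_unit.
have := fac_nil nu1; have := fac_nil nu2.
by case: (fac Q1) => [|? [|? ?]] //; case: (fac Q2).
Qed.

Lemma unique_fac Q : wf Q -> nonunit Q ->
  unique_exact_factorization L0 h (lang Q) (fac Q).
Proof.
move=> wfQ nuQ; split.
  split; [exact: fac_nil | | exact: lprods_fac].
  by move=> P /is_prime_fac/relative_primeP.
move=> s [_ prime_s eq_Q]; apply/esym/fac_unique => // P /prime_s.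
by move/relative_primeP.
Qed.

Theorem theorem9p8 :
  (forall P : set word, relative_prime L0 h P <->
     (P = pA \/ P = pB \/ P = pC \/ P = pD \/ P = pE \/ P = pF \/ P = pG)) /\
  (forall X : set word, live_nonunit_class L0 h X ->
     exists! s : seq (set word), exact_factorization L0 h X s) /\
  (forall X : set word, live_nonunit_class L0 h X <->
     ((exists r : nat, (1 <= r)%N /\ X = clA r) \/
      (exists r : nat, (1 <= r)%N /\ X = clB r) \/
      (exists d : int, X = clC d) \/
      (exists c e : nat, (1 <= c)%N /\ (1 <= e)%N /\ X = clX c e) \/
      (exists c e : nat, (1 <= c)%N /\ X = clY c e) \/
      (exists c e : nat, (1 <= e)%N /\ X = clZ c e) \/
      (exists c e : nat, X = clW c e))) /\
  (forall r : nat, (1 <= r)%N ->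
     unique_exact_factorization L0 h (clA r) (facA r)) /\
  (forall r : nat, (1 <= r)%N ->
     unique_exact_factorization L0 h (clB r) (facB r)) /\
  (forall d : int, unique_exact_factorization L0 h (clC d) (facC d)) /\
  (forall c e : nat, (1 <= c)%N -> (1 <= e)%N ->
     unique_exact_factorization L0 h (clX c e) (facX c e)) /\
  (forall c e : nat, (1 <= c)%N ->
     unique_exact_factorization L0 h (clY c e) (facY c e)) /\
  (forall c e : nat, (1 <= e)%N ->
     unique_exact_factorization L0 h (clZ c e) (facZ c e)) /\
  (forall c e : nat,
     unique_exact_factorization L0 h (clW c e) (facW c e)).
Proof.
split; first exact: relative_primeP.
split.
  move=> X /live_nonunit_classP[Q [wfQ nuQ ->]].
  by exists (fac Q); apply: unique_fac.
split.
  move=> X; rewrite live_nonunit_classP; split.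
    case=> -[r|r|d|f c e l] [wfQ nuQ ->].
    - by left; exists r; split=> //; case: r nuQ {wfQ}.
    - by right; left; exists r; split=> //; case: r nuQ {wfQ}.
    - by right; right; left; exists d.
    - do 3!right; case: f l wfQ {nuQ} => -[] /andP[fc le].
      + by do 3!right; exists c, e.
      + by do 2!right; left; exists c, e; rewrite lang_Z.
      + by right; left; exists c, e; rewrite lang_Y.
      + by left; exists c, e; rewrite lang_X.
  case=> [[r [r_gt0 ->]]|[[r [r_gt0 ->]]|[[d ->]|[[c [e [c_gt0 [e_gt0 ->]]]]|
      [[c [e [c_gt0 ->]]]|[[c [e [e_gt0 ->]]]|[c [e ->]]]]]]]].
  - by exists (IA r); split=> //; case: r r_gt0.
  - by exists (IB r); split=> //; case: r r_gt0.
  - by exists (IC d).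
  - by exists (IT false c e false); rewrite lang_X /= c_gt0 e_gt0.
  - by exists (IT false c e true); rewrite lang_Y /= c_gt0.
  - by exists (IT true c e false); rewrite lang_Z /= e_gt0.
  - by exists (IT true c e true).
split; first by move=> r r_gt0; apply: (@unique_fac (IA r)); case: r r_gt0.
split; first by move=> r r_gt0; apply: (@unique_fac (IB r)); case: r r_gt0.
split; first by move=> d; apply: (@unique_fac (IC d)).
split.
  move=> c e c_gt0 e_gt0; rewrite -lang_X -fac_X //.
  by apply: unique_fac; rewrite //= c_gt0.
split.
  move=> c e c_gt0; rewrite -lang_Y -fac_Y //.
  by apply: unique_fac; rewrite //= c_gt0.
split.
  move=> c e e_gt0; rewrite -lang_Z -fac_Z //.
  by apply: unique_fac.
by move=> c e; rewrite -fac_W; apply: (@unique_fac (IT true c e true)).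
Qed.
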